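(* Call an integer triple $(a,b,c)$ a solution to the Sum of Consecutive Squares (SoCS) Problem if $0<a+1<b<c$ and $$(a+1)^2+(a+2)^2+\cdots+b^2=(b+1)^2+(b+2)^2+\cdots+c^2 .$$ Then: (i) for every arithmetic polygon whose side lengths (in order of traversal starting at the special vertex $O$) are $a+1,a+2,\dots,c$, there is an integer $b$ with $a+1<b<c$ such that $(a,b,c)$ is a solution to the SoCS Problem; (ii) for every solution $(a,b,c)$ to the SoCS Problem there is at least one arithmetic polygon with side lengths $a+1,a+2,\dots,c$. Thus there is a surjective map from arithmetic polygons to solutions of the SoCS Problem, and this map is many-to-one (not injective).
   Context: An arithmetic polygon is a (closed) polygon in the plane with integer side lengths and a distinguished vertex $O$ satisfying: (1) as one traverses the polygon starting and finishing at $O$, each side has length exactly one greater than the length of the side preceding it (so the sides have lengths $a+1,a+2,\dots,c$ for some integers $a,c$); (2) for each side of the polygon, there is a line perpendicular to that side which passes through both $O$ and one of the two endpoints of that side; (3) no vertex is degenerate, i.e., no vertex has an angle of $0$ or $\pi$ radians. *)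

(* Defs.v *)
From mathcomp Require Import all_boot all_order all_algebra.
From mathcomp Require Import boolp classical_sets reals trigo.

Set Implicit Arguments.
Unset Strict Implicit.
Unset Printing Implicit Defensive.

Import Order.TTheory GRing.Theory Num.Theory.
Local Open Scope classical_set_scope.
Local Open Scope ring_scope.

(* (m+1)^2 + (m+2)^2 + ... + n^2, meaningful for m <= n (absz would otherwise
   give |n - m| terms). *)
Definition sum_squares (m n : int) : int :=
  \sum_(i < absz (n - m)) (m + i.+1%:Z) ^+ 2.

Definition SoCS (a b c : int) : bool :=
  [&& 0 < a + 1, a + 1 < b, b < c & sum_squares a b == sum_squares b c].

Definition SoCS_solution : Type :=
  {t : int * int * int | SoCS t.1.1 t.1.2 t.2}.

Section Plane.
Variable R : realType.

(* The library norm on row vectors is the sup norm, hence the explicit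
   Euclidean structure. *)
Definition dot (u v : 'rV[R]_2) : R := \sum_i u 0 i * v 0 i.

Definition enorm (u : 'rV[R]_2) : R := Num.sqrt (dot u u).

(* Unoriented angle at q between the rays towards p and r, in [0, pi]. *)
Definition angle (p q r : 'rV[R]_2) : R :=
  acos (dot (p - q) (r - q) / (enorm (p - q) * enorm (r - q))).

Definition line (p d : 'rV[R]_2) : set 'rV[R]_2 :=
  [set x | exists t : R, x = p + t *: d].

(* Indices are taken modulo the number of vertices, which closes the polygon. *)
Definition vertex (s : seq 'rV[R]_2) (i : nat) : 'rV[R]_2 :=
  nth 0 s (i %% size s).

Definition side (s : seq 'rV[R]_2) (i : nat) : 'rV[R]_2 :=
  vertex s i.+1 - vertex s i.

(* Sides may cross, but vertices are distinct; in particular the traversal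
   from O meets O again only at its end. Without this, gluing at O polygons for
   (59, 110, 135) and (135, 144, 152) would give a closed path with sides
   60, ..., 152, although no (59, b, 152) is a solution. *)
Definition polygon (s : seq 'rV[R]_2) : Prop := (3 <= size s)%N /\ uniq s.

Definition perpendicular_through (O : 'rV[R]_2) (s : seq 'rV[R]_2) (i : nat) :
    Prop :=
  exists p d : 'rV[R]_2,
    [/\ d != 0,
        dot d (side s i) = 0,
        line p d O &
        line p d (vertex s i) \/ line p d (vertex s i.+1)].

(* s lists the vertices in order of traversal, the distinguished vertex O
   being vertex s 0. *)
Definition arithmetic_polygon (a c : int) (s : seq 'rV[R]_2) : Prop :=
  [/\ polygon s,
      (size s)%:Z = c - a,
      forall i, (i < size s)%N -> enorm (side s i) = (a + i.+1%:Z)%:~R,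
      forall i, (i < size s)%N -> perpendicular_through (vertex s 0) s i &
      forall i, (i < size s)%N ->
        let theta := angle (vertex s i) (vertex s i.+1) (vertex s i.+2) in
        theta <> 0 /\ theta <> pi].

Record arithPolygon : Type := ArithPolygon {
  ap_a : int;
  ap_c : int;
  ap_vertices : seq 'rV[R]_2;
  ap_axioms : arithmetic_polygon ap_a ap_c ap_vertices
}.

(* Reflections are allowed, and vertices correspond in order of traversal. *)
Definition congruent (s t : seq 'rV[R]_2) : Prop :=
  exists g : 'rV[R]_2 -> 'rV[R]_2,
    (forall x y, enorm (g x - g y) = enorm (x - y)) /\ map g s = t.

End Plane.

(* Main.v *)
(** Let [v_0 = O, v_1, ..., v_n = O] be the traversal and put
    [r_i = |v_i - O|^2]. Perpendicularity at side [i] is a right angle of the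
    triangle [O v_i v_{i+1}] at [v_i] or at [v_{i+1}], so Pythagoras gives
    [r_{i+1} = r_i + l_i^2] (ascent) or [r_{i+1} = r_i - l_i^2] (descent). A
    descent followed by an ascent makes both sides at the common vertex
    orthogonal to the same vector, hence the vertex degenerate. So ascents come
    first, [b - a] is their number, and [r_n = 0] is the SoCS equation.

    Conversely, each ascent or descent can be made in two mirror-image ways, and
    only non-consecutive coincidences [v_i = v_j] and the angle at [O] can go
    wrong. A point reached by a descent collides with at most one point of the
    ascending phase, as the [r_i] increase there, so one of the two ways is
    safe; and [v_1], which takes part in no collision, can be reflected in the
    line [O v_2] to make the angle at [O] nondegenerate.

    For (9, 12, 14) the two choices of [v_4] give polygons with different
    distances [|v_2 - v_4|]. *)
Require Import Defs.
From mathcomp Require Import all_boot all_order all_algebra.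
From mathcomp Require Import boolp classical_sets reals trigo.
From mathcomp Require Import ring lra zify.

Set Implicit Arguments.
Unset Strict Implicit.

Import Order.TTheory GRing.Theory Num.Theory.
Local Open Scope ring_scope.

(** * Dot product, determinant and angles in the plane *)

Section PlaneLemmas.
Context {R : realType}.
Implicit Types (u v w x y z : 'rV[R]_2).

Definition pt (a b : R) : 'rV[R]_2 := \row_j (if j == 0 then a else b).

Definition det2 u v : R := u 0 0 * v 0 1 - u 0 1 * v 0 0.

Definition rot90 u : 'rV[R]_2 := pt (- u 0 1) (u 0 0).

Lemma ptE a b : (pt a b 0 0 = a) * (pt a b 0 1 = b).
Proof. by rewrite /pt !mxE. Qed.

Lemma dotE u v : dot u v = u 0 0 * v 0 0 + u 0 1 * v 0 1.
Proof.
rewrite /dot big_ord_recl big_ord1.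
by congr (_ * _ + u 0 _ * v 0 _); apply: val_inj.
Qed.

Lemma dotC u v : dot u v = dot v u.
Proof. by rewrite !dotE; ring. Qed.

Lemma rowP2 u v : u 0 0 = v 0 0 -> u 0 1 = v 0 1 -> u = v.
Proof.
move=> e0 e1; apply/rowP => j.
case: (unliftP 0 j) => [i|] -> //.
by rewrite ord1; move: e1; congr (u 0 _ = v 0 _); apply: val_inj.
Qed.

Lemma dot_ge0 u : 0 <= dot u u.
Proof. by rewrite dotE; nra. Qed.

Lemma dot_eq0 u : (dot u u == 0) = (u == 0).
Proof.
apply/eqP/eqP => [|->]; last by rewrite dotE !mxE; ring.
rewrite dotE => e; apply: rowP2; rewrite mxE; nra.
Qed.

Lemma dot_gt0 u : (0 < dot u u) = (u != 0).
Proof. by rewrite lt0r dot_ge0 andbT dot_eq0. Qed.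

Lemma lagrange_dot u v :
  dot u v ^+ 2 + det2 u v ^+ 2 = dot u u * dot v v.
Proof. by rewrite !dotE /det2; ring. Qed.

Lemma enorm_ge0 u : 0 <= enorm u.
Proof. exact: sqrtr_ge0. Qed.

Lemma sqr_enorm u : enorm u ^+ 2 = dot u u.
Proof. by rewrite sqr_sqrtr // dot_ge0. Qed.

Lemma orthogonal_collinear x y z :
  y != 0 -> dot x y = 0 -> det2 z y = 0 -> dot x z = 0.
Proof.
rewrite -dot_gt0 => y0 xy zy.
apply: (mulIf (lt0r_neq0 y0)); rewrite mul0r.
transitivity (dot x y * dot z y + det2 x y * det2 z y).
  by rewrite !dotE /det2; ring.
by rewrite xy zy; ring.
Qed.

Lemma orthogonal_det x y z :
  x != 0 -> dot x y = 0 -> dot x z = 0 -> det2 y z = 0.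
Proof.
rewrite -dot_gt0 => x0 xy xz.
apply: (mulIf (lt0r_neq0 x0)); rewrite mul0r.
transitivity (dot x y * det2 x z - dot x z * det2 x y).
  by rewrite !dotE /det2; ring.
by rewrite xy xz; ring.
Qed.

(** Cramer's rule for the basis [u], [v]. *)
Lemma eq_dot2 u v x y :
  det2 u v != 0 -> dot u x = dot u y -> dot v x = dot v y -> x = y.
Proof.
move=> d eu ev; apply: rowP2; apply: (mulfI d).
- transitivity (v 0 1 * dot u x - u 0 1 * dot v x).
    by rewrite !dotE /det2; ring.
  by rewrite eu ev !dotE /det2; ring.
- transitivity (u 0 0 * dot v x - v 0 0 * dot u x).
    by rewrite !dotE /det2; ring.
  by rewrite eu ev !dotE /det2; ring.
Qed.

(** By Lagrange's identity the squares of the cosine and of the normalised determinant add up to 1,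
    so the cosine is 1 or -1 exactly when the determinant vanishes. *)
Lemma angle_degenerate p q r : p - q != 0 -> r - q != 0 ->
  (angle p q r = 0 \/ angle p q r = pi) <-> det2 (p - q) (r - q) = 0.
Proof.
move=> pq rq; have := lagrange_dot (p - q) (r - q).
rewrite /angle -!sqr_enorm.
move: (pq) (rq); rewrite -!dot_gt0 -!sqr_enorm => pq0 rq0.
set a := enorm (p - q) in pq0 *; set b := enorm (r - q) in rq0 *.
have a0 : 0 < a.
  rewrite lt0r enorm_ge0 andbT; apply: contraTneq pq0 => ->.
  by rewrite expr0n ltxx.
have b0 : 0 < b.
  rewrite lt0r enorm_ge0 andbT; apply: contraTneq rq0 => ->.
  by rewrite expr0n ltxx.
set d := dot _ _; set e := det2 _ _ => L.
have ab0 : a * b != 0 by rewrite mulf_neq0 ?gt_eqF.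
have {L}L : (d / (a * b)) ^+ 2 + (e / (a * b)) ^+ 2 = 1.
  by rewrite !expr_div_n -mulrDl L -exprMn divff // expf_neq0.
have /andP[x1 x2] : -1 <= d / (a * b) <= 1 by nra.
have eE : e = 0 <-> (d / (a * b)) ^+ 2 = 1.
  split=> [e0|h]; first by rewrite -L e0 mul0r expr0n addr0.
  have /eqP : (e / (a * b)) ^+ 2 = 0 by lra.
  by rewrite sqrf_eq0 mulf_eq0 invr_eq0 (negPf ab0) orbF => /eqP.
split.
- case=> h; apply/eE.
  + have := @acosK R (d / (a * b)).
    rewrite in_itv /= x1 x2 h cos0 => <- //; by rewrite expr1n.
  + have := @acosK R (d / (a * b)).
    rewrite in_itv /= x1 x2 h cospi => <- //; by rewrite sqrrN expr1n.
- move=> /eE /eqP; rewrite sqrf_eq1 => /orP[] /eqP ->.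
  + by left; rewrite acos1.
  + by right; rewrite acosN1.
Qed.

End PlaneLemmas.

(** * Perpendicularity and nondegeneracy as vector equations *)

Section Polygons.
Context {R : realType}.
Implicit Types (p q u v w x y z : 'rV[R]_2) (s : seq 'rV[R]_2).

Lemma mulrot90 u v :
  dot u v = 0 -> dot v v *: u = det2 v u *: rot90 v.
Proof.
move=> e; apply: rowP2; rewrite !mxE /= /det2.
- transitivity (v 0 0 * dot u v + (v 0 0 * u 0 1 - v 0 1 * u 0 0) * (- v 0 1)).
    by rewrite !dotE; ring.
  by rewrite e; ring.
- transitivity (v 0 1 * dot u v + (v 0 0 * u 0 1 - v 0 1 * u 0 0) * (v 0 0)).
    by rewrite !dotE; ring.
  by rewrite e; ring.
Qed.

Lemma dot_rot90 v : dot (rot90 v) v = 0.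
Proof. by rewrite dotE /rot90 !ptE; ring. Qed.

Lemma dot_rot90_rot90 v : dot (rot90 v) (rot90 v) = dot v v.
Proof. by rewrite !dotE /rot90 !ptE; ring. Qed.

Lemma dotBl u v w : dot (u - v) w = dot u w - dot v w.
Proof. by rewrite !dotE !mxE; ring. Qed.

Lemma dotBr u v w : dot u (v - w) = dot u v - dot u w.
Proof. by rewrite !dotE !mxE; ring. Qed.

Lemma dotZl t u v : dot (t *: u) v = t * dot u v.
Proof. by rewrite !dotE !mxE; ring. Qed.

Lemma dot0l u : dot 0 u = 0.
Proof. by rewrite dotE !mxE; ring. Qed.

(** Two points of the line differ by a multiple of [d]; conversely, the line through [O] in the
    direction [rot90] of the side serves. *)
Lemma perpendicular_throughP O s i : side s i != 0 ->
  perpendicular_through O s i <->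
  dot (vertex s i - O) (side s i) = 0 \/
  dot (vertex s i.+1 - O) (side s i) = 0.
Proof.
set w := side s i => w0; split.
- move=> [p [d [_ dw [t Ot]]]].
  have key V : line p d V -> dot (V - O) w = 0.
    move=> [t' ->]; rewrite Ot opprD addrACA subrr add0r -scalerBl.
    by rewrite dotZl dw mulr0.
  by case=> /key; [left|right].
- have lineO V : dot (V - O) w = 0 -> line O (rot90 w) V.
    move=> /mulrot90 e; exists (det2 w (V - O) / dot w w).
    rewrite mulrC -scalerA -e scalerA mulVf ?dot_eq0 // scale1r.
    by rewrite addrC subrK.
  move=> h; exists O, (rot90 w); split.
  + by rewrite -dot_eq0 dot_rot90_rot90 dot_eq0.
  + exact: dot_rot90.
  + by exists 0; rewrite scale0r addr0.
  + by case: h => /lineO; [left|right].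
Qed.

Lemma vertex_mkseq (v : nat -> 'rV[R]_2) n i :
  (0 < n)%N -> vertex (mkseq v n) i = v (i %% n)%N.
Proof. by move=> n0; rewrite /vertex size_mkseq nth_mkseq // ltn_pmod. Qed.

(** With [O] at the origin, the cases are two ascents, two descents, and the peak. If the sides were
    parallel, the first two cases would make a side orthogonal to itself; at the peak [p] and [z]
    would be the same foot of the perpendicular from [O], and the sides equally long. *)
Lemma turn_nondegenerate p q z :
  q - p != 0 -> z - q != 0 ->
  [\/ dot p (q - p) = 0 /\ dot q (z - q) = 0,
      dot q (q - p) = 0 /\ dot z (z - q) = 0 |
      [/\ dot p (q - p) = 0, dot z (z - q) = 0 &
          dot (q - p) (q - p) != dot (z - q) (z - q)]] ->
  det2 (p - q) (z - q) != 0.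
Proof.
move=> qp0 sq0 h; apply/negP => /eqP e.
have e1 : det2 (q - p) (z - q) = 0 by move: e; rewrite /det2 !mxE => e; nra.
have e2 : det2 (z - q) (q - p) = 0 by move: e; rewrite /det2 !mxE => e; nra.
case: h => [[h1 h2]|[h1 h2]|[h1 h2 /eqP h3]].
- have := orthogonal_collinear sq0 h2 e1 => h3.
  by move: qp0; rewrite -dot_eq0 dotBl h3 h1 subrr eqxx.
- have := orthogonal_collinear qp0 h1 e2 => h3.
  by move: sq0; rewrite -dot_eq0 dotBl h2 h3 subrr eqxx.
- have h4 := orthogonal_collinear qp0 h1 e2.
  have h5 := orthogonal_collinear sq0 h2 e1.
  have /eqP : dot (z - p) (z - p) = 0.
    have -> : dot (z - p) (z - p) =
      dot z (z - q) - dot p (z - q) + (dot z (q - p) - dot p (q - p)).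
      by rewrite !dotE !mxE; ring.
    by rewrite h1 h2 h4 h5; ring.
  rewrite dot_eq0 subr_eq0 => /eqP sp; apply: h3; rewrite sp.
  by rewrite !dotE !mxE; ring.
Qed.

(** The vectors [p] and [q] are independent, being a leg and the hypotenuse of a right triangle, and
    the hypotheses fix the dot products of the apex with both. This tells the two feet over [q]
    apart by their distance from [p]. *)
Lemma right_triangle_apex_inj p q x y :
  p != 0 -> q - p != 0 -> dot p (q - p) = 0 ->
  dot x (x - q) = 0 -> dot y (y - q) = 0 -> dot x x = dot y y ->
  dot (p - x) (p - x) = dot (p - y) (p - y) -> x = y.
Proof.
move=> p0 qp0 pq xq yq xy pxy; apply: (@eq_dot2 _ p q).
- apply/negP => /eqP d; move/negP: p0; apply.
  rewrite -dot_eq0; apply/eqP; apply: orthogonal_collinear qp0 pq _.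
  by rewrite -d /det2 !mxE; ring.
- by move: pxy; rewrite !dotBl !dotBr (dotC x p) (dotC y p); lra.
- by move: xq yq; rewrite !dotBr (dotC q x) (dotC q y); lra.
Qed.

(** Putting [O] at the origin and repeating it as [v n] removes the indices modulo [n]; only the
    angle at [O] then needs a condition of its own. *)
Lemma arithmetic_polygon_mkseq (a c : int) (n : nat) (v : nat -> 'rV[R]_2) :
  0 < a + 1 -> n%:Z = c - a -> (2 < n)%N -> v 0%N = 0 -> v n = 0 ->
  (forall i j, (i < j < n)%N -> v i != v j) ->
  (forall i, (i < n)%N -> let w := v i.+1 - v i in
     dot w w = (a + i.+1%:Z)%:~R ^+ 2 /\
     (dot (v i) w = 0 \/ dot (v i.+1) w = 0)) ->
  (forall i, (i.+1 < n)%N -> det2 (v i - v i.+1) (v i.+2 - v i.+1) != 0) ->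
  det2 (v n.-1) (v 1%N) != 0 ->
  arithmetic_polygon a c (mkseq v n).
Proof.
move=> a0 nac n2 v0 vn inj sd turn endturn.
have n0 : (0 < n)%N by lia.
have V i : (i <= n)%N -> vertex (mkseq v n) i = v i.
  rewrite leq_eqVlt vertex_mkseq // => /orP[/eqP ->|lin].
    by rewrite modnn v0 vn.
  by rewrite modn_small.
have len i : 0 < (a + i.+1%:Z)%:~R :> R by rewrite ltr0z; lia.
have S i : (i < n)%N -> side (mkseq v n) i = v i.+1 - v i.
  by move=> lin; rewrite /side !V // ltnW.
have S0 i : (i < n)%N -> v i.+1 - v i != 0.
  by move=> lin; rewrite -dot_gt0 (sd _ lin).1 exprn_gt0.
split.
- split; first by rewrite size_mkseq.
  apply/(uniqP 0) => i j; rewrite !inE !size_mkseq => li lj.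
  rewrite !nth_mkseq // => e.
  have [ij|ij|//] := ltngtP i j.
    by have := inj i j; rewrite ij lj e eqxx => /(_ isT).
  by have := inj j i; rewrite ij li e eqxx => /(_ isT).
- by rewrite size_mkseq.
- rewrite size_mkseq => i lin; rewrite S // /enorm (sd _ lin).1.
  by rewrite sqrtr_sqr ger0_norm // ltW.
- rewrite size_mkseq => i lin; apply/perpendicular_throughP.
    by rewrite S // S0.
  rewrite S // (V i.+1) // (V i (ltnW lin)) (V 0%N) // v0 !subr0.
  exact: (sd _ lin).2.
- rewrite size_mkseq => i lin.
  suff : let p := vertex (mkseq v n) i in let q := vertex (mkseq v n) i.+1 in
      let s := vertex (mkseq v n) i.+2 in
      [/\ p - q != 0, s - q != 0 & det2 (p - q) (s - q) != 0].
    move=> /= [pq sq /eqP d]; have [deg _] := angle_degenerate pq sq.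
    by split=> t; apply: d; apply: deg; [left|right].
  rewrite /= (V i) ?(V i.+1) //; last exact: ltnW.
  have pq : v i - v i.+1 != 0 by rewrite -opprB oppr_eq0 S0.
  have [lin'|lni] := ltnP i.+1 n.
    by rewrite (V i.+2) //; split; [exact: pq | exact: S0 | exact: turn].
  (* The angle at [O]: vertex [i.+2] wraps around to [v 1]. *)
  have ni : n = i.+1 by apply/eqP; rewrite eqn_leq lni.
  have -> : vertex (mkseq v n) i.+2 = v 1%N.
    by rewrite vertex_mkseq // -[i.+2]addn1 -ni modnDl modn_small // ltnW.
  have := S0 _ n0; move: endturn pq; rewrite ni /= -ni vn v0 !subr0.
  by split.
Qed.

End Polygons.

(** * Ascending and descending steps by right triangles *)

Section Spiral.
Context {R : realType}.
Implicit Types (p q u v w x y z : 'rV[R]_2).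

(** For nonzero [v] and positive [l], the end of a leg of length [l] erected at [v] on the
    counterclockwise side. *)
Definition climb (l : R) v := v + (l / Num.sqrt (dot v v)) *: rot90 v.

Lemma climbP l v (w := climb l v) : v != 0 ->
  dot v (w - v) = 0 /\ dot w w = dot v v + l ^+ 2.
Proof.
move=> v0; rewrite {}/w /climb.
have vp : 0 < dot v v by rewrite dot_gt0.
have s2 : Num.sqrt (dot v v) ^+ 2 = dot v v by rewrite sqr_sqrtr ?ltW.
have s0 : Num.sqrt (dot v v) != 0 by rewrite gt_eqF // sqrtr_gt0.
set t := l / _; have tE : t ^+ 2 * dot v v = l ^+ 2.
  by rewrite expr_div_n s2 divfK // gt_eqF.
rewrite addrC addKr dotC dotZl dot_rot90 mulr0; split=> //.
by rewrite -tE !dotE /rot90 !mxE /=; ring.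
Qed.

(* The feet of the two right triangles with hypotenuse [v] and a leg of squared
   length [t] at the origin, according to the sign [e]. *)
Definition descend (e t l : R) v :=
  (t / dot v v) *: v + (e * Num.sqrt t * l / dot v v) *: rot90 v.

Lemma descendP e t l v (w := descend e t l v) :
  0 < t -> e ^+ 2 = 1 -> dot v v = t + l ^+ 2 ->
  dot w (v - w) = 0 /\ dot w w = t.
Proof.
move=> t0 e1 vv; rewrite {}/w /descend.
have s2 : Num.sqrt t ^+ 2 = t by rewrite sqr_sqrtr ?ltW.
have v0 : dot v v != 0 by rewrite vv gt_eqF // ltr_pwDl // sqr_ge0.
set a := t / _; set b := _ / _.
have av : a * dot v v = t by rewrite divfK.
have bv : b * dot v v = e * Num.sqrt t * l by rewrite divfK.
have ww : dot (a *: v + b *: rot90 v) (a *: v + b *: rot90 v) = t.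
  transitivity ((a ^+ 2 + b ^+ 2) * dot v v).
    by rewrite !dotE /rot90 !mxE /=; ring.
  (* Multiplied by [dot v v], the claim reads t^2 + t l^2 = t (t + l^2). *)
  apply: (mulIf v0).
  transitivity ((a * dot v v) ^+ 2 + (b * dot v v) ^+ 2); first by ring.
  by rewrite av bv vv !exprMn e1 s2; ring.
split=> //; rewrite dotBr ww.
have -> : dot (a *: v + b *: rot90 v) v = a * dot v v.
  by rewrite !dotE /rot90 !mxE /=; ring.
by rewrite av subrr.
Qed.

Lemma descend_neq t l v : 0 < t -> 0 < l -> v != 0 ->
  descend 1 t l v != descend (-1) t l v.
Proof.
move=> t0 l0; rewrite -dot_gt0 => v0; rewrite /descend.
rewrite (inj_eq (addrI _)) -subr_eq0 -scalerBl -dot_eq0.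
rewrite dotZl dotC dotZl dot_rot90_rot90 !mul1r !mulN1r !mulNr opprK -mulr2n.
by rewrite gt_eqF // !mulr_gt0 ?pmulrn_lgt0 ?divr_gt0 ?mulr_gt0 ?sqrtr_gt0.
Qed.

(* One of the two feet is not on the line spanned by [z]: otherwise [z] would
   be orthogonal to both [rot90 v] and [v]. *)
Lemma descend_transversal t l v z : 0 < t -> 0 < l -> v != 0 -> z != 0 ->
  exists2 e, e ^+ 2 = 1 & det2 z (descend e t l v) != 0.
Proof.
move=> t0 l0 v0; apply: contraNP => h.
have d e : e ^+ 2 = 1 -> det2 z (descend e t l v) = 0.
  by move=> e1; apply/eqP/negPn/negP => d; apply: h; exists e.
have := d (-1) (sqrr_sign _ 1); have := d 1 (expr1n _ _).
move: (v0); rewrite -dot_gt0 => vv.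
rewrite /descend mulN1r mul1r !mulNr.
set a := t / _; set b := _ / _ => d1 d2.
have a0 : a != 0 by rewrite gt_eqF // divr_gt0.
have b0 : b != 0 by rewrite gt_eqF // divr_gt0 // mulr_gt0 ?sqrtr_gt0.
have zv : det2 z v = 0.
  apply: (mulfI a0); move: d1 d2; rewrite /det2 /rot90 !mxE /=; lra.
have zr : dot v z = 0.
  apply: (mulfI b0); move: d1 d2; rewrite dotE /det2 /rot90 !mxE /=; lra.
have zv' := orthogonal_collinear v0 (_ : dot z v = 0) zv.
by rewrite -dot_eq0 zv' ?eqxx // dotC.
Qed.

(* The first [k] steps ascend; each later one takes the foot that avoids
   [phi i]. The value at [i = 1] is provisional, see [exists_chain]. *)
Fixpoint spiral (l r : nat -> R) k (phi : nat -> 'rV[R]_2) (i : nat)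
    : 'rV[R]_2 :=
  if i is j.+1 then
    let p := spiral l r k phi j in
    if j == 0%N then pt (l 0%N) 0 else
    if (j < k)%N then climb (l j) p else
    let q := descend 1 (r i) (l j) p in
    if q == phi i then descend (-1) (r i) (l j) p else q
  else 0.

Lemma spiralS l r k phi i (p := spiral l r k phi i) : (0 < i)%N ->
  spiral l r k phi i.+1 =
    if (i < k)%N then climb (l i) p else
    let q := descend 1 (r i.+1) (l i) p in
    if q == phi i.+1 then descend (-1) (r i.+1) (l i) p else q.
Proof. by case: i @p => // i. Qed.

(** Lets [phi] be defined from the ascending points without circularity. *)
Lemma spiral_climb l r k phi phi' i :
  (i <= k)%N -> spiral l r k phi i = spiral l r k phi' i.
Proof.
elim: i => //= i IHi ik; rewrite IHi ?ik //; exact: ltnW.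
Qed.

(** The two feet are distinct, so when the first is forbidden the other is not. *)
Lemma spiral_neq l r k phi i :
  (forall j, 0 < l j) -> 0 < r i -> spiral l r k phi i.-1 != 0 ->
  (0 < k)%N -> (k < i)%N -> spiral l r k phi i != phi i.
Proof.
case: i => //= i l0 ri p0 k0 ki.
rewrite gtn_eqF ?(leq_trans k0) // ltnNge -ltnS ki /=.
case: ifP => [/eqP <-|/negbT //]; rewrite eq_sym; exact: descend_neq.
Qed.

End Spiral.

(** * Closed chains with prescribed squared distances from the origin *)

Section Profile.
Context {R : realType}.
Variables (l r : nat -> R) (k n : nat).
Hypothesis l_gt0 : forall i, 0 < l i.
Hypothesis l_lt : forall i j, (i < j)%N -> l i < l j.
Hypothesis k_gt1 : (1 < k)%N.
Hypothesis k_lt_n : (k < n)%N.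
Hypothesis r0 : r 0%N = 0.
Hypothesis r_up : forall i, (i < k)%N -> r i.+1 = r i + l i ^+ 2.
Hypothesis r_down : forall i, (k <= i)%N -> r i = r i.+1 + l i ^+ 2.
Hypothesis rn : r n = 0.

Lemma r_lt_up i j : (i < j)%N -> (j <= k)%N -> r i < r j.
Proof.
elim: j => // j IHj; rewrite ltnS leq_eqVlt => /orP[/eqP ->|ij] jk.
  by rewrite r_up // ltrDl exprn_gt0.
apply: (lt_trans (IHj ij (ltnW jk))).
by rewrite r_up // ltrDl exprn_gt0.
Qed.

Lemma r_lt_down i j : (k <= i)%N -> (i < j)%N -> r j < r i.
Proof.
move=> ki; elim: j => // j IHj; rewrite ltnS leq_eqVlt => /orP[/eqP <-|ij].
  by rewrite [r i]r_down // ltrDl exprn_gt0.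
apply: lt_trans (IHj ij).
by rewrite [r j]r_down ?ltrDl ?exprn_gt0 // (leq_trans ki) // ltnW.
Qed.

Lemma r_gt0 i : (0 < i < n)%N -> 0 < r i.
Proof.
move=> /andP[i0 lin]; have [ik|ki] := leqP i k.
  by rewrite -r0 r_lt_up.
by rewrite -rn r_lt_down // ltnW.
Qed.

(** Induction with [climbP] and [descendP]. The last descent, to [O] itself, is left out because
    [descendP] asks for a positive squared length. *)
Lemma spiralP phi i (v := spiral l r k phi) : (0 < i < n)%N ->
  [/\ dot (v i) (v i) = r i,
      (i < k)%N -> dot (v i) (v i.+1 - v i) = 0 &
      (k <= i)%N -> (i.+1 < n)%N -> dot (v i.+1) (v i.+1 - v i) = 0].
Proof.
suff norm j : (0 < j < n)%N -> dot (v j) (v j) = r j.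
  move=> lin; have /andP[i0 _] := lin.
  have vi : v i != 0 by rewrite -dot_gt0 norm // r_gt0.
  split; first exact: norm.
  - by move=> ik; rewrite /v spiralS // ik -/v; exact: (climbP _ vi).1.
  - move=> ki lin'; rewrite -opprB -scaleN1r dotC dotZl dotC.
    have key e : e ^+ 2 = 1 -> let w := descend e (r i.+1) (l i) (v i) in
        -1 * dot w (v i - w) = 0.
      move=> e1 w; rewrite (descendP _ e1 _).1 ?mulr0 ?r_gt0 //.
      by rewrite norm // r_down.
    rewrite /v spiralS // ltnNge ki -/v /=.
    by case: ifP => _; apply: key; rewrite ?sqrrN ?expr1n.
elim: j => // -[|j] IHj jn.
  by rewrite /v /= dotE /pt !mxE /= r_up ?r0 ?(ltnW k_gt1)//; ring.
have jn' : (0 < j.+1 < n)%N by exact: ltnW.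
have vj : v j.+1 != 0 by rewrite -dot_gt0 IHj // r_gt0.
rewrite /v spiralS // -/v; case: ltnP => [jk|kj].
  by rewrite (climbP _ vj).2 IHj // (r_up jk).
have key e : e ^+ 2 = 1 -> let w := descend e (r j.+2) (l j.+1) (v j.+1) in
    dot w w = r j.+2.
  move=> e1; apply: (descendP _ e1 _).2; first by rewrite r_gt0.
  by rewrite IHj // r_down.
by rewrite /=; case: ifP => _; apply: key; rewrite ?sqrrN ?expr1n.
Qed.

(* [v_1] is chosen last: it is not involved in any collision, since
   [r 1 < r n.-1], hence only has to avoid the line of the last side. *)
Lemma exists_chain phi :
  (forall i j, (1 < i < k)%N -> (k < j < n)%N -> r i = r j ->
     phi j = spiral l r k phi i) ->
  exists v : nat -> 'rV[R]_2,
  [/\ [/\ v 0%N = 0, v n = 0 &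
        forall i, (1 < i < n)%N -> v i = spiral l r k phi i],
      forall i j, (i < j < n)%N -> v i != v j,
      forall i, (i < n)%N -> let w := v i.+1 - v i in
        dot w w = l i ^+ 2 /\ (dot (v i) w = 0 \/ dot (v i.+1) w = 0),
      forall i, (i.+1 < n)%N -> det2 (v i - v i.+1) (v i.+2 - v i.+1) != 0 &
      det2 (v n.-1) (v 1%N) != 0].
Proof.
move=> coll; set u := spiral l r k phi.
have n2 : (2 < n)%N by exact: leq_trans k_lt_n.
have uP := @spiralP phi.
have u0 i : (0 < i < n)%N -> u i != 0.
  by move=> lin; have [e _ _] := uP _ lin; rewrite -dot_gt0 e r_gt0.
have r1 : r 1%N = l 0%N ^+ 2 by rewrite r_up ?r0 ?add0r // ltnW.
have r1_gt0 : 0 < r 1%N by rewrite r1 exprn_gt0.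
have u2 : dot (u 2) (u 2) = r 1%N + l 1%N ^+ 2.
  by have [-> _ _] := uP 2 n2; rewrite (r_up k_gt1).
(* The new [v 1] keeps the lengths of the first two sides and their right angles, and lies off the
   line through [O] and [u n.-1]. *)
have [e e1 etrans] := descend_transversal r1_gt0 (l_gt0 1) (u0 2 n2)
  (u0 n.-1 ltac:(lia)).
have [p_foot p_norm] := descendP r1_gt0 e1 u2.
set p := descend _ _ _ _ in etrans p_foot p_norm.
pose v i := if i == 0%N then 0 else if i == 1%N then p else
  if (i < n)%N then u i else 0.
have v0 : v 0%N = 0 by [].
have v1 : v 1%N = p by [].
have vn : v n = 0 by rewrite /v ltnn; case: (n) n2 => [|[|?]].
have vE i : (1 < i < n)%N -> v i = u i.
  by case: i => [|[|i]] // /andP[_ lin]; rewrite /v lin.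
have norm i : (i <= n)%N -> dot (v i) (v i) = r i.
  rewrite leq_eqVlt => /orP[/eqP ->|]; first by rewrite vn dot0l rn.
  case: i => [_|[_|i lin]]; rewrite ?v0 ?dot0l ?r0 ?v1 //.
  by rewrite vE //; have [] := uP i.+2 lin.
have up i : (i < k)%N -> dot (v i) (v i.+1 - v i) = 0.
  case: i => [_|[_|i ik]]; [by rewrite v0 dot0l | by rewrite v1 vE|].
  rewrite !vE; try lia.
  have [|_ h _] := uP i.+2; [lia | exact: h].
have down i : (k <= i < n)%N -> dot (v i.+1) (v i.+1 - v i) = 0.
  move=> /andP[ki lin]; have [lin'|] := ltnP i.+1 n.
    rewrite !vE; try lia.
    have [|_ _ h] := uP i; [lia | exact: h].
  move=> ni; suff -> : i.+1 = n by rewrite vn dot0l.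
  by apply/eqP; rewrite eqn_leq lin.
have right i : (i < n)%N -> (i < k)%N /\ dot (v i) (v i.+1 - v i) = 0 \/
    (k <= i)%N /\ dot (v i.+1) (v i.+1 - v i) = 0.
  move=> lin; have [ik|ki] := ltnP i k; [left|right]; split=> //.
    exact: up.
  by apply: down; rewrite ki.
(* Pythagoras, at whichever end of the side the right angle is. *)
have len i : (i < n)%N -> dot (v i.+1 - v i) (v i.+1 - v i) = l i ^+ 2.
  move=> lin; have := norm i.+1 lin; have := norm i (ltnW lin).
  rewrite !dotBl !dotBr; case: (right i lin) => -[ik].
    by rewrite (r_up ik) dotBr [dot (v i.+1) (v i)]dotC => h1 h2 h3; lra.
  by rewrite (r_down ik) dotBr [dot (v i.+1) (v i)]dotC => h1 h2 h3; lra.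
have side0 i : (i < n)%N -> v i.+1 - v i != 0.
  by move=> lin; rewrite -dot_gt0 len // exprn_gt0.
exists v; split.
- by split.
- move=> i j /andP[ij jn].
  have lin : (i < n)%N by exact: ltn_trans jn.
  suff : v i = v j -> False by move=> h; apply/eqP.
  (* Equal points have equal [r], and [r] is strictly monotone on either side of [k], so a collision
     needs [i < k < j]. *)
  move=> vij; have := norm i (ltnW lin); rewrite vij norm ?(ltnW jn) // => rij.
  have [jk|kj] := leqP j k; first by have := r_lt_up ij jk; rewrite rij ltxx.
  have [ki|ik] := leqP k i; first by have := r_lt_down ki ij; rewrite rij ltxx.
  have i0 : (0 < i)%N.
    case: i {ij lin vij ik} rij => // rij.
    by have := @r_gt0 j; rewrite jn (leq_trans _ kj) // rij r0 ltxx => /(_ isT).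
  have i1 : (1 < i)%N.
    rewrite ltn_neqAle i0 andbT; apply/eqP => i1.
    (* The first side is shorter than the last: [r 1 = l 0 ^+ 2 < l n.-1 ^+ 2 = r n.-1 <= r j]. *)
    have : r 1%N < r j.
      have : r 1%N < r n.-1.
        rewrite r1 (@r_down n.-1); last lia.
        rewrite prednK ?rn ?add0r; last lia.
        by rewrite ltrXn2r // ?ltW // l_lt //; lia.
      move=> /lt_le_trans; apply.
      have [->//|jn1] := eqVneq j n.-1.
      by rewrite ltW // r_lt_down //; lia.
    by rewrite rij i1 ltxx.
  have j0 : (0 < j < n)%N by rewrite jn (leq_trans _ kj).
  have j1 : (0 < j.-1 < n)%N by lia.
  (* By [coll], [phi j] is [u i], which [u j] avoids. *)
  have := spiral_neq l_gt0 (r_gt0 j0) (u0 _ j1) (ltnW k_gt1) kj.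
  rewrite (coll i j) ?i1 ?ik ?kj ?jn // -/u -(vE i) ?i1 ?lin //.
  by rewrite -(vE j) ?vij ?eqxx // jn (ltn_trans k_gt1 kj).
- move=> i lin w; split; first exact: len.
  by case: (right i lin) => -[_]; [left|right].
- move=> i lin; apply: turn_nondegenerate; rewrite ?side0 //; first exact: ltnW.
  case: (right i (ltnW lin)) => -[ik h1]; case: (right i.+1 lin) => -[ik' h2].
  + by apply: Or31.
  (* The peak, where the second side is longer than the first. *)
  + apply: Or33; split=> //; rewrite !len // 1?ltnW // lt_eqF //.
    by rewrite ltrXn2r // ?ltW // l_lt.
  + by move: (leq_trans ik' ik); rewrite ltnNge leqnSn.
  + by apply: Or32.
- by rewrite v1 vE //; lia.
Qed.

End Profile.

(** * Solutions by offsets from a, and uniqueness of b *)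

Lemma sum_squares_nat (a : int) (m n : nat) : (m <= n)%N ->
  sum_squares (a + m%:Z) (a + n%:Z) = \sum_(m <= i < n) (a + i.+1%:Z) ^+ 2.
Proof.
move=> mn; rewrite /sum_squares -[m in RHS]add0n big_addn big_mkord.
have -> : absz (a + n%:Z - (a + m%:Z))%R = (n - m)%N by lia.
by apply: eq_bigr => i _; congr (_ ^+ 2); lia.
Qed.

(** The offsets [k] and [n] become the numbers of ascents and of sides. *)
Lemma SoCSP (a b c : int) :
  SoCS a b c <->
  exists k n : nat, [/\ b = a + k%:Z, c = a + n%:Z, 0 < a + 1, (1 < k < n)%N &
    \sum_(0 <= i < k) (a + i.+1%:Z) ^+ 2 =
      \sum_(k <= i < n) (a + i.+1%:Z) ^+ 2].
Proof.
split.
- case/and4P => a0 ab bc /eqP e; exists (absz (b - a)%R), (absz (c - a)%R).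
  have bE : b = a + (absz (b - a)%R)%:Z by lia.
  have cE : c = a + (absz (c - a)%R)%:Z by lia.
  split=> //; first by apply/andP; split; lia.
  by rewrite -!sum_squares_nat -?bE -?cE ?addr0 //; lia.
- move=> [k [n [-> -> a0 /andP[k1 kn] e]]]; apply/and4P; split=> //; try lia.
  by rewrite -{1}[a]addr0 !sum_squares_nat ?e // ltnW.
Qed.

(** Moving the split point up enlarges the left sum and shrinks the right one. *)
Lemma SoCS_inj (a b b' c : int) : SoCS a b c -> SoCS a b' c -> b = b'.
Proof.
move=> /SoCSP [k [n [-> -> a0 /andP[k1 kn] e]]].
move=> /SoCSP [k' [n' [-> nn' _ /andP[k1' kn'] e']]].
have {nn'} nn' : n' = n by lia.
rewrite {}nn' in kn' e'.
pose S i j : int := \sum_(i <= m < j) (a + m.+1%:Z) ^+ 2.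
have lt i j : (i < j)%N -> (j < n)%N ->
    S 0%N i = S i n -> S 0%N j = S j n -> False.
  move=> ij jn.
  have S0 : 0 < S i j.
    rewrite /S big_ltn // ltr_pwDl ?exprn_gt0 //; first lia.
    by apply: sumr_ge0 => m _; exact: sqr_ge0.
  have -> : S 0%N j = S 0%N i + S i j by rewrite /S -big_cat_nat //= ltnW.
  have -> : S i n = S i j + S j n by rewrite /S -big_cat_nat //= ltnW.
  lia.
have [kk|kk|-> //] := ltngtP k k'.
  by case: (lt k k').
by case: (lt k' k).
Qed.

(** * From arithmetic polygons to solutions *)

Section ArithmeticPolygonToSoCS.
Context {R : realType}.
Implicit Types (s : seq 'rV[R]_2).

Lemma arithmetic_polygon_SoCS (a c : int) s :
  arithmetic_polygon a c s -> exists2 b : int, a + 1 < b < c & SoCS a b c.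
Proof.
move=> [[n2 us] nac len perp turn].
set n := size s in n2 nac len perp turn.
have n0 : (0 < n)%N by exact: leq_trans n2.
pose O := vertex s 0; pose x i := vertex s i - O.
pose L i : int := (a + i.+1%:Z) ^+ 2.
have sx i : side s i = x i.+1 - x i by rewrite /side /x opprB addrA subrK.
have x0 : x 0%N = 0 by rewrite /x subrr.
have xn : x n = 0 by rewrite /x /vertex modnn /O /vertex mod0n subrr.
have vinj i j : (i < j < n)%N -> vertex s i != vertex s j.
  move=> /andP[ij jn]; have lin := ltn_trans ij jn.
  by rewrite /vertex !modn_small // nth_uniq // ltn_eqF.
have xneq0 i : (0 < i < n)%N -> x i != 0.
  by move=> lin; rewrite subr_eq0 eq_sym vinj.
have side0 i : (i < n)%N -> side s i != 0.
  move=> lin; have [lin'|ni] := ltnP i.+1 n.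
    by rewrite subr_eq0 eq_sym vinj // ltnSn.
  have E : i.+1 = n by apply/eqP; rewrite eqn_leq lin.
  by rewrite sx E xn sub0r oppr_eq0 xneq0 // lin andbT -ltnS E ltnW.
(* Lengths are norms of nonzero sides, hence positive; the first side yields [0 < a + 1]. *)
have L_gt0 i : (i < n)%N -> 0 < a + i.+1%:Z.
  move=> lin; have := side0 i lin; rewrite -dot_gt0 -sqr_enorm len //.
  move=> h; have : (0 : R) <= (a + i.+1%:Z)%:~R by rewrite -len // enorm_ge0.
  rewrite ler0z le_eqVlt => /orP[/eqP e|//].
  by move: h; rewrite -e rmorph0 expr0n !ltxx.
have a0 : 0 < a + 1 by exact: (L_gt0 0%N).
have LE i : (i < n)%N -> dot (side s i) (side s i) = (L i)%:~R.
  by move=> lin; rewrite -sqr_enorm len // -rmorphXn.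
(* A right angle at the start of the side is an ascent, one at its end a descent. *)
pose up i := dot (x i) (side s i) == 0.
pose dn i := dot (x i.+1) (side s i) == 0.
have updn i : (i < n)%N -> up i || dn i.
  move=> lin; have /perpendicular_throughP := perp i lin.
  by rewrite side0 // => /(_ isT) [] /eqP h; apply/orP; [left|right].
(* Otherwise both sides at the common vertex are orthogonal to the nonzero [x i.+1], hence
   parallel. *)
have dndn i : dn i -> (i.+1 < n)%N -> dn i.+1.
  move=> /eqP di lin; have := updn _ lin.
  case: (boolP (up i.+1)) => //= /eqP ui.
  have xi : x i.+1 != 0 by exact: xneq0.
  have d := orthogonal_det xi di ui.
  have /= [t0 tpi] := turn i (ltnW lin); move: t0 tpi.
  set p := vertex s i; set q := vertex s i.+1; set r := vertex s i.+2.
  have pq : p - q != 0 by rewrite -opprB oppr_eq0 side0 // ltnW.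
  have rq : r - q != 0 by exact: side0.
  have [_ deg] := angle_degenerate pq rq.
  move=> t0 tpi; suff /deg [/t0|/tpi] : det2 (p - q) (r - q) = 0 by [].
  by move: d; rewrite /det2 /side !mxE; lra.
have norm_up i : (i < n)%N -> up i ->
    dot (x i.+1) (x i.+1) = dot (x i) (x i) + (L i)%:~R.
  move=> lin /eqP; rewrite -LE // sx !dotE !mxE; lra.
have norm_dn i : (i < n)%N -> dn i ->
    dot (x i) (x i) = dot (x i.+1) (x i.+1) + (L i)%:~R.
  move=> lin /eqP; rewrite -LE // sx !dotE !mxE; lra.
(* Take for [k] the first side that is not an ascent, or [n]; from there on [dndn] propagates the
   descents. *)
have [k kn [k_up k_dn]] : exists2 k, (k <= n)%N &
    (forall i, (i < k)%N -> up i) /\ (forall i, (k <= i < n)%N -> dn i).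
  have ex : exists k, (k == n) || ~~ up k by exists n; rewrite eqxx.
  case: (ex_minnP ex) => k kP kmin; exists k.
    by apply: kmin; rewrite eqxx.
  split=> [i ik|i /andP[ki lin]].
    apply/negPn/negP => ui; have := kmin i; rewrite ui orbT => /(_ isT).
    by rewrite leqNgt ik.
  have kltn : (k < n)%N by exact: leq_ltn_trans lin.
  have dk : dn k.
    by move: kP (updn _ kltn); rewrite ltn_eqF //= => /negPf ->.
  elim: i ki lin => [|i IHi]; first by rewrite leqn0 => /eqP <-.
  rewrite leq_eqVlt => /orP[/eqP <- //|ki lin].
  by apply: dndn => //; apply: IHi => //; exact: ltnW.
have sum_up i : (i <= k)%N ->
    dot (x i) (x i) = (\sum_(0 <= j < i) L j)%:~R.
  elim: i => [|i IHi] ik; first by rewrite x0 dot0l big_geq.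
  rewrite norm_up ?k_up ?(leq_trans ik) // IHi ?(ltnW ik) //.
  by rewrite big_nat_recr //= rmorphD.
have sum_dn i : (k <= i <= n)%N ->
    dot (x k) (x k) = dot (x i) (x i) + (\sum_(k <= j < i) L j)%:~R.
  elim: i => [|i IHi] /andP[ki lin].
    by move: ki; rewrite leqn0 => /eqP ->; rewrite big_geq // addr0.
  move: ki; rewrite leq_eqVlt => /orP[/eqP <-|ki].
    by rewrite big_geq ?addr0.
  have dni : dn i by apply: k_dn; rewrite lin andbT.
  rewrite IHi ?(ltnW lin) ?andbT // big_nat_recr //= rmorphD norm_dn //.
  by rewrite addrA addrAC.
(* The squared distance at vertex [k], summed from both ends of the traversal. *)
have balance : \sum_(0 <= j < k) L j = \sum_(k <= j < n) L j.
  apply/eqP; rewrite -(eqr_int R) -sum_up // (sum_dn n) ?kn ?leqnn //.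
  by rewrite xn dot0l add0r.
have Lsum_ge0 i j : 0 <= \sum_(i <= m < j) L m.
  by apply: sumr_ge0 => m _; exact: sqr_ge0.
have L0 : 0 < L 0%N by rewrite exprn_gt0 // L_gt0.
(* If [k] were 0 or [n], one sum would be empty and the other positive; [k = 1] fails because
   [L 0 < L 1]. *)
have k0 : (0 < k)%N.
  case: (posnP k) => // k0; move: balance.
  rewrite k0 big_geq // big_ltn // => e.
  by move: (ltr_pwDl L0 (Lsum_ge0 1%N n)); rewrite -e ltxx.
have kltn : (k < n)%N.
  rewrite ltn_neqAle kn andbT; apply/eqP => E.
  move: balance; rewrite -E big_ltn // [RHS]big_geq // => e.
  by move: (ltr_pwDl L0 (Lsum_ge0 1%N k)); rewrite e ltxx.
have k1 : (1 < k)%N.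
  rewrite ltn_neqAle k0 andbT; apply/eqP => E.
  move: balance; rewrite -E big_nat1 [RHS]big_ltn; last by rewrite E.
  have L01 : L 0%N < L 1%N by rewrite /L ltrXn2r ?ltW ?L_gt0 // ltrD2l.
  by move=> e; move: (ltr_wpDr (Lsum_ge0 2 n) L01); rewrite -e ltxx.
exists (a + k%:Z); first by lia.
apply/SoCSP; exists k, n; split=> //; first by lia.
by rewrite k1.
Qed.

End ArithmeticPolygonToSoCS.

(** * From solutions to arithmetic polygons, and two polygons for one solution *)

Section SoCSToArithmeticPolygon.
Context {R : realType}.
Implicit Types (s : seq 'rV[R]_2).

Definition len (a : int) (i : nat) : R := (a + i.+1%:Z)%:~R.

(** The squared distance of vertex [i] from [O] when the first [k] sides ascend and the later ones
    descend; the exponent is a boolean read as 0 or 1. *)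
Definition sqdist (a : int) (k i : nat) : R :=
  \sum_(0 <= j < i) (-1) ^+ (k <= j)%N * len a j ^+ 2.

Lemma len_gt0 a i : 0 < a + 1 -> 0 < len a i.
Proof. by move=> a0; rewrite ltr0z; lia. Qed.

Lemma len_lt a i j : (i < j)%N -> len a i < len a j.
Proof. by move=> ij; rewrite ltr_int; lia. Qed.

Lemma sqdist0 a k : sqdist a k 0 = 0.
Proof. by rewrite /sqdist big_geq. Qed.

Lemma sqdist_up a k i :
  (i < k)%N -> sqdist a k i.+1 = sqdist a k i + len a i ^+ 2.
Proof. by move=> ik; rewrite /sqdist big_nat_recr //= leqNgt ik mul1r. Qed.

Lemma sqdist_down a k i :
  (k <= i)%N -> sqdist a k i = sqdist a k i.+1 + len a i ^+ 2.
Proof. by move=> ki; rewrite /sqdist big_nat_recr //= ki mulN1r subrK. Qed.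

Section Existence.
Variables (a : int) (k n : nat).
Hypothesis a1_gt0 : 0 < a + 1.
Hypothesis k_gt1 : (1 < k)%N.
Hypothesis k_lt_n : (k < n)%N.
Hypothesis balance :
  \sum_(0 <= i < k) (a + i.+1%:Z) ^+ 2 = \sum_(k <= i < n) (a + i.+1%:Z) ^+ 2.

Lemma sqdistn : sqdist a k n = 0.
Proof.
have /(congr1 (fun z : int => z%:~R : R)) := balance.
rewrite !rmorph_sum /= => e.
rewrite /sqdist (@big_cat_nat _ _ _ k) //= ?(ltnW k_lt_n) //.
rewrite (eq_big_nat _ _ (F2 := fun j => ((a + j.+1%:Z) ^+ 2)%:~R)); last first.
  by move=> j /andP[_ jk]; rewrite leqNgt jk mul1r rmorphXn.
rewrite e -big_split big_nat big1 // => j /andP[kj _].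
by rewrite kj mulN1r rmorphXn; exact: subrr.
Qed.

(** Keeping [phi] a parameter and describing the vertices allows different polygons to be built for
    one solution. *)
Lemma exists_arithmetic_polygon phi :
  (forall i j, (1 < i < k)%N -> (k < j < n)%N -> sqdist a k i = sqdist a k j ->
     phi j = spiral (len a) (sqdist a k) k phi i) ->
  exists v : nat -> 'rV[R]_2,
    arithmetic_polygon a (a + n%:Z) (mkseq v n) /\
    forall i, (1 < i < n)%N -> v i = spiral (len a) (sqdist a k) k phi i.
Proof.
move=> coll.
have [v [[v0 vn vE] inj sd turn endturn]] := exists_chain
  (fun i => len_gt0 i a1_gt0) (@len_lt a) k_gt1 k_lt_n (sqdist0 a k)
  (@sqdist_up a k) (@sqdist_down a k)
  sqdistn coll.
exists v; split=> //; apply: arithmetic_polygon_mkseq => //; first by lia.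
exact: leq_ltn_trans k_lt_n.
Qed.

End Existence.

Lemma SoCS_arithmetic_polygon (a b c : int) :
  SoCS a b c -> exists s, arithmetic_polygon a c s.
Proof.
move=> /SoCSP [k [n [_ -> a0 /andP[k1 kn] e]]].
pose r := sqdist a k; pose u := spiral (len a) r k (fun=> 0).
(* The ascending point at the same distance from [O] as vertex [j]; if there is none, [find] returns
   [k] and [u k] is a harmless default. *)
pose phi j := u (find (fun i => r i == r j) (iota 0 k)).
have [i j /andP[i1 ik] _ rij|v [vP _]] :=
    @exists_arithmetic_polygon a k n a0 k1 kn e phi.
  rewrite (@spiral_climb _ _ _ _ _ (fun=> 0)) ?(ltnW ik) //; congr (u _).
  (* As [r] increases up to [k], the index found can only be [i]. *)
  have up m m' : (m < m')%N -> (m' <= k)%N -> r m < r m'.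
    exact: (r_lt_up (fun i => len_gt0 i a0) (@sqdist_up a k)).
  have h : has (fun m => r m == r j) (iota 0 k).
    by apply/hasP; exists i; rewrite ?mem_iota //; apply/eqP.
  have := h; rewrite has_find size_iota => fk.
  have /eqP := nth_find 0%N h; rewrite nth_iota // add0n.
  set m := find _ _ in fk *; rewrite -[r j]rij -/(r i) => rf.
  have [mi|im|//] := ltngtP m i.
    by have := up m i mi (ltnW ik); rewrite rf ltxx.
  by have := up i m im (ltnW fk); rewrite rf ltxx.
by exists (mkseq v n).
Qed.

Lemma congruent_mkseq (v w : nat -> 'rV[R]_2) n i j :
  congruent (mkseq v n) (mkseq w n) -> (i < n)%N -> (j < n)%N ->
  dot (w i - w j) (w i - w j) = dot (v i - v j) (v i - v j).
Proof.
move=> [g [iso e]] lin ljn.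
have gE m : (m < n)%N -> g (v m) = w m.
  move=> mn; have := congr1 (fun s => nth 0 s m) e.
  by rewrite (nth_map 0) ?size_mkseq // !nth_mkseq.
by rewrite -!sqr_enorm -!gE // iso.
Qed.

Lemma noncongruent_arithmetic_polygons :
  exists s s' : seq 'rV[R]_2,
    [/\ arithmetic_polygon 9 14 s, arithmetic_polygon 9 14 s' &
        ~ congruent s s'].
Proof.
have a0 : 0 < 9 + 1 :> int by [].
have e : \sum_(0 <= i < 3) (9 + i.+1%:Z) ^+ 2 =
    \sum_(3 <= i < 5) (9 + i.+1%:Z) ^+ 2 :> int.
  by rewrite /index_iota !unlock.
set r := sqdist 9 3.
(* Only vertices 2 and 4 could collide, and their squared distances are 221 and 196, so every [phi]
   is admissible. *)
have coll phi i j : (1 < i < 3)%N -> (3 < j < 5)%N -> r i = r j ->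
    phi j = spiral (len 9) r 3 phi i.
  move=> i2 j4; have -> : i = 2%N by lia.
  have -> : j = 4%N by lia.
  rewrite /r (@sqdist_down 9 3 4) // (sqdistn (k := 3) (n := 5) isT e).
  rewrite (@sqdist_up 9 3 1) // (@sqdist_up 9 3 0) // sqdist0.
  have [l0 l1 l4] : [/\ len 9 0 = 10, len 9 1 = 11 & len 9 4 = 14] by [].
  rewrite l0 l1 l4 => h.
  have : 0 + 14 ^+ 2 < 0 + 10 ^+ 2 + 11 ^+ 2 :> R by lra.
  by rewrite h ltxx.
have poly phi := @exists_arithmetic_polygon 9 3 5 a0 isT isT e phi (coll phi).
have r0 := sqdist0 9 3; have rn := sqdistn (k := 3) (n := 5) isT e.
have r_up := @sqdist_up 9 3; have r_dn := @sqdist_down 9 3.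
have l_gt0 i := len_gt0 i a0.
have sP phi := spiralP (k := 3) (n := 5) l_gt0 isT r0 r_up r_dn rn phi.
have rp := r_gt0 (k := 3) (n := 5) l_gt0 r0 r_up r_dn rn.
pose u := spiral (len 9) r 3.
(* Forbidding the fourth vertex of the first polygon makes the second one take the other foot. *)
pose phi0 (_ : nat) : 'rV[R]_2 := 0; pose phi1 (_ : nat) := u phi0 4%N.
have [v [vP vE]] := poly phi0; have [w [wP wE]] := poly phi1.
exists (mkseq v 5), (mkseq w 5); split=> // cong.
have := congruent_mkseq (i := 2) (j := 4) cong isT isT.
rewrite (vE 2%N isT) (vE 4%N isT) (wE 2%N isT) (wE 4%N isT).
rewrite -/(u phi0) -/(u phi1).
have same i : (i <= 3)%N -> u phi1 i = u phi0 i by exact: spiral_climb.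
rewrite (same 2%N isT) => eq24.
have [n2 o2 _] := sP phi0 2%N isT; have [n3 _ o3] := sP phi0 3%N isT.
have [_ _ o3'] := sP phi1 3%N isT.
have [n4 _ _] := sP phi0 4%N isT; have [n4' _ _] := sP phi1 4%N isT.
move: o3 o3' n2 o2 n3 n4 n4'; rewrite -!/(u _) (same 3%N isT).
move=> /(_ isT isT) o3 /(_ isT isT) o3' n2 /(_ isT) o2 n3 n4 n4'.
have u3 : u phi1 3 != 0 by rewrite (same 3%N isT) -dot_gt0 n3 rp.
(* The fourth vertices differ by construction, but equal distances from vertex 2 would identify
   them. *)
have := spiral_neq l_gt0 (rp 4%N isT) u3 isT isT.
apply/negP/negPn; rewrite -/(u phi1) /phi1.
apply/eqP; apply: right_triangle_apex_inj o2 o3' o3 _ eq24.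
- by rewrite -dot_gt0 n2 rp.
- rewrite subr_eq0; apply: contraTneq (r_lt_up l_gt0 r_up (ltnSn 2) isT) => e23.
  by rewrite -n2 -n3 e23 ltxx.
- exact: etrans n4' (esym n4).
Qed.

End SoCSToArithmeticPolygon.

Theorem theorem1p2 (R : realType) :
  [/\ forall (a c : int) (s : seq 'rV[R]_2), arithmetic_polygon a c s ->
        exists b : int, a + 1 < b < c /\ SoCS a b c,
      forall a b c : int, SoCS a b c ->
        exists s : seq 'rV[R]_2, arithmetic_polygon a c s &
      exists f : arithPolygon R -> SoCS_solution,
        [/\ forall P, exists b : int, val (f P) = (ap_a P, b, ap_c P),
            forall t, exists P, f P = t &
            exists P Q, ~ congruent (ap_vertices P) (ap_vertices Q) /\
                        f P = f Q]].
Proof.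
split.
- by move=> a c s /arithmetic_polygon_SoCS [b ? ?]; exists b.
- exact: SoCS_arithmetic_polygon.
- have /choice [f fE] : forall P : arithPolygon R, exists t : SoCS_solution,
      exists b : int, val t = (ap_a P, b, ap_c P).
    move=> P; have [b _ ab] := arithmetic_polygon_SoCS (ap_axioms P).
    by exists (exist _ (ap_a P, b, ap_c P) ab), b.
  (* Since [a] and [c] determine [b], any solution with the right [a] and [c] is the value of [f];
     this gives surjectivity and the common value of two noncongruent polygons. *)
  have f_det P t b : val t = (ap_a P, b, ap_c P) -> f P = t.
    move=> tE; apply: val_inj; have [b' fPE] := fE P; rewrite fPE tE.
    have := valP (f P); have := valP t; rewrite /= fPE tE /=.
    by move=> /SoCS_inj h /h ->.
  exists f; split=> // [[[[a b] c] abc]|].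
    have [s sP] := SoCS_arithmetic_polygon (R := R) abc.
    by exists (ArithPolygon sP); apply: f_det.
  have [s [s' [sP s'P ncong]]] := noncongruent_arithmetic_polygons (R := R).
  exists (ArithPolygon sP), (ArithPolygon s'P); split=> //.
  have [b fQ] := fE (ArithPolygon s'P).
  exact: f_det (ArithPolygon sP) _ b fQ.
Qed.
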